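(* Let $E$ be a metrisable topological space and $I$ a non-empty set for which there is an increasing sequence $(I_n)_{n\in\mathbb{N}}$ of non-empty sets in $I$ such that $\bigcup_{n\in\mathbb{N}}I_n=I$. Let $S$ be a non-empty set in $E^I$ such that each $x\in E^I$ lies in $S$ if there is a sequence $(x_n)_{n\in\mathbb{N}}$ in $S$ such that $x=x_n$ on $I_n$ for each $n\in\mathbb{N}$. Let $F:\ell_+\to\mathbb{R}_+$ be increasing and subadditive and vanish only at $\mathbf{0}$. Further, let $(d_i)_{i\in\mathbb{N}}$ be a sequence of pseudometrics on $S$ such that $$\lim_{v\to0}F\bigg(\sum_{i=1}^jv_ie_i\bigg)=0\quad\text{for all }j\in\mathbb{N}\quad\text{and}\quad\lim_{j\uparrow\infty}\sup_{x,y\in S}F\bigg(\sum_{i=j}^\infty d_i(x,y)e_i\bigg)=0,$$ the topology induced by $d_{i+1}$ is finer than that of $d_i$ for each $i\in\mathbb{N}$, and for any $i\in\mathbb{N}$ and $x,y\in S$ we have $$d_i(x,y)=0\quad\Leftrightarrow\quad x=y\ \text{ on }I_i.$$ Then the metric $d$ on $S$ given by $d(x,y):=F((d_i(x,y))_{i\in\mathbb{N}})$ has the following properties: (i) A sequence in $S$ converges relative to $d$ if and only if there is a point in $S$ to which it converges relative to $d_i$ for any $i\in\mathbb{N}$. (ii) A sequence in $S$ is Cauchy relative to $d$ if and only if it is Cauchy with respect to $d_i$ for all $i\in\mathbb{N}$. Further, $d$ is complete if $d_i$ is for any $i\in\mathbb{N}$, and $d$ turns $S$ into a separable space if $d_i$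 does for each $i\in\mathbb{N}$.
   Context: $\mathbb{R}_+=[0,\infty)$. $E^I$ is the set of all maps from $I$ to $E$. $\ell_+$ is the convex cone of all sequences $a=(a_i)_{i\in\mathbb{N}}$ in $\mathbb{R}_+$, $e_i$ is the $i$th canonical basis vector in $\ell_+$, $\mathbf{0}:=(0)_{i\in\mathbb{N}}$, and $\sum_{i=j}^\infty a_ie_i$ denotes the sequence whose first $j-1$ entries are $0$ and whose $i$th entry is $a_i$ for $i\ge j$. $F$ is increasing if $F(a)\le F(b)$ for any $a,b\in\ell_+$ with $a_i\le b_i$ for each $i\in\mathbb{N}$. In the limit $v\to0$, $v=(v_1,\dots,v_j)$ ranges over $\mathbb{R}_+^j$. ''Finer'' is meant in the non-strict sense. *)

(* Defs.v *)
From HB Require Import structures.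
From mathcomp Require Import all_boot all_order all_algebra.
From mathcomp Require Import all_classical all_reals all_analysis.

Set Implicit Arguments.
Unset Strict Implicit.
Unset Printing Implicit Defensive.

Import Order.TTheory GRing.Theory Num.Theory.
Import numFieldNormedType.Exports.

Local Open Scope classical_set_scope.
Local Open Scope ring_scope.

Record pseudometric (R : realType) (T : Type) := Pseudometric {
  pm_dist :> T -> T -> R ;
  pm_ge0 : forall x y, 0 <= pm_dist x y ;
  pm_xx : forall x, pm_dist x x = 0 ;
  pm_sym : forall x y, pm_dist x y = pm_dist y x ;
  pm_triangle : forall y x z, pm_dist x z <= pm_dist x y + pm_dist y z
}.

Definition is_metric (R : realType) (T : Type) (d : pseudometric R T) : Prop :=
  forall x y, d x y = 0 -> x = y.

(** [pm_space d] is a copy of [T] carrying the topology and the uniformity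
    induced by [d], so that several pseudometrics on [T] can be compared; it
    hides any topology that [T] may already have. *)
Definition pm_space (R : realType) (T : Type) (d : pseudometric R T)
  : Type := T.

HB.instance Definition _ (R : realType) (T : Type)
  (d : pseudometric R T) := gen_eqMixin (pm_space d).
HB.instance Definition _ (R : realType) (T : Type)
  (d : pseudometric R T) := gen_choiceMixin (pm_space d).

Definition pm_ball (R : realType) (T : Type) (d : pseudometric R T)
  (x : pm_space d) (e : R) : set (pm_space d) := [set y | d x y < e].

Definition pm_ent (R : realType) (T : Type) (d : pseudometric R T)
  : set_system (pm_space d * pm_space d) := entourage_ (@pm_ball R T d).

HB.instance Definition _ (R : realType) (T : Type)
  (d : pseudometric R T) := hasNbhs.Build (pm_space d) (nbhs_ (@pm_ent R T d)).

Lemma pm_ball_center (R : realType) (T : Type) (d : pseudometric R T)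
  (x : pm_space d) (e : R) : 0 < e -> pm_ball x e x.
Proof. by move=> e0; rewrite /pm_ball /= pm_xx. Qed.

Lemma pm_ball_sym (R : realType) (T : Type) (d : pseudometric R T)
  (x y : pm_space d) (e : R) : pm_ball x e y -> pm_ball y e x.
Proof. by rewrite /pm_ball /= pm_sym. Qed.

Lemma pm_ball_triangle (R : realType) (T : Type) (d : pseudometric R T)
  (x y z : pm_space d) (e1 e2 : R) :
  pm_ball x e1 y -> pm_ball y e2 z -> pm_ball x (e1 + e2) z.
Proof.
by rewrite /pm_ball /= => xy yz; rewrite (le_lt_trans (pm_triangle d y x z))// ltrD.
Qed.

HB.instance Definition _ (R : realType) (T : Type)
  (d : pseudometric R T) :=
  @Nbhs_isPseudoMetric.Build R (pm_space d) (@pm_ent R T d) erefl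
    (@pm_ball R T d) (@pm_ball_center R T d) (@pm_ball_sym R T d)
    (@pm_ball_triangle R T d) erefl.

Definition pm_open (R : realType) (T : Type) (d : pseudometric R T)
  (A : set T) : Prop := @open (pm_space d) A.

Definition pm_finer (R : realType) (T : Type) (d1 d2 : pseudometric R T)
  : Prop := @pm_open R T d2 `<=` @pm_open R T d1.

Definition pm_cvg_to (R : realType) (T : Type) (d : pseudometric R T)
  (u : nat -> T) (x : T) : Prop :=
  (u : nat -> pm_space d) @ \oo --> (x : pm_space d).

Definition pm_cauchy (R : realType) (T : Type) (d : pseudometric R T)
  (u : nat -> T) : Prop := cauchy ((u : nat -> pm_space d) @ \oo).

Definition pm_complete (R : realType) (T : Type) (d : pseudometric R T)
  : Prop := forall u, pm_cauchy d u -> exists x, pm_cvg_to d u x.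

Definition pm_separable (R : realType) (T : Type) (d : pseudometric R T)
  : Prop := exists2 A : set T, countable A & dense (A : set (pm_space d)).

Definition metrisable (R : realType) (E : topologicalType) : Prop :=
  exists d : pseudometric R E,
    is_metric d /\ forall A : set E, open A <-> pm_open d A.

(** Sequences are indexed from 0. A function on the cone is encoded as a total
    function on [nat -> R] whose hypotheses are restricted to [ell_plus]. *)
Definition ell_plus (R : realType) : set (nat -> R) :=
  [set a | forall i, 0 <= a i].

Definition e_ (R : realType) (i : nat) : nat -> R := fun k => (k == i)%:R.

Definition tail (R : realType) (j : nat) (a : nat -> R) : nat -> R :=
  fun i => if (j <= i)%N then a i else 0.

(* Main.v *)
Require Import Defs.
From HB Require Import structures.
From mathcomp Require Import all_boot all_order all_algebra.
From mathcomp Require Import all_classical all_reals all_analysis.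

Set Implicit Arguments.
Unset Strict Implicit.
Unset Printing Implicit Defensive.

Import Order.TTheory GRing.Theory Num.Theory.
Import numFieldNormedType.Exports.

Local Open Scope classical_set_scope.
Local Open Scope ring_scope.

(** Since [F] is increasing and subadditive, [d] is at most [F] of the first
    coordinates plus [F] of the remaining tail. The tail is uniformly small on
    [S], so [d] is small as soon as finitely many [d_ i] are; conversely a small
    [d] forces each [d_ i] to be small, because [F] is positive on [e *: e_ i].
    This gives the equivalences for convergence and for Cauchy sequences. For
    completeness, the [d_ i]-limits of a Cauchy sequence agree on [I_ i] with
    the [d_ i.+1]-limits, as the topology of [d_ i.+1] is finer, and hence they
    glue to a single point of [S]. *)

(** * Topological notions in terms of distances *)

Section pseudometric_space.
Variables (R : realType) (T : Type).
Implicit Types (d : pseudometric R T) (u : nat -> T) (x y : T).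

Lemma pm_cvg_toP d u x : pm_cvg_to d u x <->
  forall e, 0 < e -> \forall n \near \oo, d x (u n) < e.
Proof. exact: (@cvg_ballP _ (pm_space d)). Qed.

Lemma pm_cauchyP d u : pm_cauchy d u <->
  forall e, 0 < e -> \forall m & n \near \oo, d (u m) (u n) < e.
Proof.
rewrite /pm_cauchy -(@cauchy_ballP _ (pm_space d)).
by split=> uc e /uc; rewrite near_map2.
Qed.

Lemma pm_cvg_to_unique d u x y :
  pm_cvg_to d u x -> pm_cvg_to d u y -> d x y = 0.
Proof.
move=> /pm_cvg_toP ux /pm_cvg_toP uy; apply/eqP; rewrite eq_le pm_ge0 andbT.
apply/ler_addgt0Pr => e e0; rewrite add0r.
have e20 : 0 < e / 2 by rewrite divr_gt0.
have [n [xn yn]] := filter_ex (filterI (ux _ e20) (uy _ e20)).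
rewrite (le_trans (pm_triangle d (u n) x y))// (splitr e) lerD ?ltW//.
by rewrite pm_sym.
Qed.

(** Limits are unique only up to distance zero; this allows replacing each [d_ i]-limit by the glued
    point. *)
Lemma pm_cvg_to_eq0 d u x y : d x y = 0 -> pm_cvg_to d u x -> pm_cvg_to d u y.
Proof.
move=> xy0 /pm_cvg_toP ux; apply/pm_cvg_toP => e /ux; apply: filterS => n.
by apply: le_lt_trans; rewrite (le_trans (pm_triangle d x y _))// pm_sym xy0 add0r.
Qed.

Lemma pm_separableP d : pm_separable d <->
  exists2 A : set T, countable A &
    forall x e, 0 < e -> exists2 a, A a & d x a < e.
Proof.
split=> -[A cA dA]; exists A => //.
  (* Density is tested on open sets, so the interior of the ball is used; it contains [x] because
     the ball is a neighbourhood of [x]. *)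
  move=> x e e0; have [||a [xa Aa]] := dA (interior (pm_ball (x : pm_space d) e)).
  - by exists x; exact: (@nbhsx_ballx _ (pm_space d) x _ e0).
  - exact: open_interior.
  - by exists a => //; exact: (interior_subset xa).
move=> O [x Ox] oO.
have /nbhs_ballP[e e0 eO] : nbhs (x : pm_space d) O by exact: open_nbhs_nbhs.
have [a Aa xa] := dA x e e0.
by exists a; split => //; exact: eO.
Qed.

(** The interior of the [d2]-ball is [d2]-open, hence [d1]-open, and so contains a [d1]-ball. The
    comparison is topological, not uniform: [r] depends on [x]. *)
Lemma pm_finer_ball d1 d2 x (e : R) : pm_finer d1 d2 -> 0 < e ->
  exists2 r, 0 < r & forall y, d1 x y < r -> d2 x y < e.
Proof.
move=> d12 e0.
have o1 := d12 _ (@open_interior (pm_space d2) (pm_ball (x : pm_space d2) e)).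
have x1 : interior (pm_ball (x : pm_space d2) e) x.
  exact: (@nbhsx_ballx _ (pm_space d2) x _ e0).
have /nbhs_ballP[r r0 rO] := open_nbhs_nbhs (conj o1 x1).
by exists r => // y /rO /interior_subset.
Qed.

Lemma pm_finer_cvg_to d1 d2 u x :
  pm_finer d1 d2 -> pm_cvg_to d1 u x -> pm_cvg_to d2 u x.
Proof.
move=> d12 /pm_cvg_toP ux; apply/pm_cvg_toP => e e0.
have [r r0 rP] := pm_finer_ball x d12 e0.
by apply: filterS (ux r r0) => n /rP.
Qed.

End pseudometric_space.

(** * A pseudometric uniformly equivalent to a sequence of pseudometrics *)

Section combination.
Variables (R : realType) (T : Type).
Variables (d_ : nat -> pseudometric R T) (d : pseudometric R T).
Hypothesis d_small : forall e : R, 0 < e -> exists j : nat,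
  exists2 r, 0 < r & forall x y,
    (forall i : 'I_j.+1, d_ i x y < r) -> d x y < e.
Hypothesis d_coord_small : forall i (e : R), 0 < e ->
  exists2 r, 0 < r & forall x y, d x y < r -> d_ i x y < e.

Lemma combination_cvg_to u x :
  pm_cvg_to d u x <-> forall i, pm_cvg_to (d_ i) u x.
Proof.
split=> [/pm_cvg_toP ux i|ux]; apply/pm_cvg_toP => e e0.
  have [r r0 rP] := d_coord_small i e0.
  by apply: filterS (ux r r0) => n; exact: rP.
have [j [r r0 rP]] := d_small e0.
suff: \forall n \near \oo, forall i : 'I_j.+1, d_ i x (u n) < r.
  by apply: filterS => n; exact: rP.
by apply: filter_forall => i; move/pm_cvg_toP : (ux i); exact.
Qed.

(** The radii in [d_small] and [d_coord_small] do not depend on the points, so the argument for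
    limits carries over to pairs of indices. *)
Lemma combination_cauchy u : pm_cauchy d u <-> forall i, pm_cauchy (d_ i) u.
Proof.
split=> [/pm_cauchyP ux i|ux]; apply/pm_cauchyP => e e0.
  have [r r0 rP] := d_coord_small i e0.
  by apply: filterS (ux r r0) => -[m n] /=; exact: rP.
have [j [r r0 rP]] := d_small e0.
suff: \forall mn \near (\oo, \oo), forall i : 'I_j.+1,
    d_ i (u mn.1) (u mn.2) < r.
  by apply: filterS => -[m n] /=; exact: rP.
apply: (filter_forall (filter_prod_filter _ _)) => i.
by move/pm_cauchyP : (ux i); exact.
Qed.

Hypothesis d_finer : forall i, pm_finer (d_ i.+1) (d_ i).

Lemma pm_finer_le i j : (i <= j)%N -> pm_finer (d_ j) (d_ i).
Proof.
move=> /subnK <-; elim: (j - i)%N => [//|k IHk] A /IHk.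
exact: d_finer.
Qed.

(* The union of dense sets for the [d_ i] is dense for [d]: a [d]-ball contains
   an intersection of finitely many [d_ i]-balls, hence a [d_ j]-ball as the
   topologies increase. *)
Lemma combination_separable :
  (forall i, pm_separable (d_ i)) -> pm_separable d.
Proof.
move=> sep; apply/pm_separableP.
have /choice[A AP] : forall i, exists A : set T, countable A /\
    forall x (e : R), 0 < e -> exists2 a, A a & d_ i x a < e.
  by move=> i; have /pm_separableP[A cA dA] := sep i; exists A.
exists (\bigcup_i A i); first by apply: bigcup_countable => // i _; case: (AP i).
move=> x e e0; have [j [r r0 rP]] := d_small e0.
have /choice[s sP] : forall i : 'I_j.+1, exists s : R, 0 < s /\
    forall y, d_ j x y < s -> d_ i x y < r.
  move=> i; have ij : (i <= j)%N by rewrite -ltnS.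
  by have [s s0 sP] := pm_finer_ball x (pm_finer_le ij) r0; exists s.
(* A single [d_ j]-radius around [x] that serves all [i <= j]; the 1 is only the starting value of
   the minimum. *)
pose t := \big[Num.min/1]_i s i.
have t0 : 0 < t by apply: lt_bigmin => // i _; case: (sP i).
have [a Aa xa] := (AP j).2 x t t0.
exists a; first by exists j.
apply: rP => i; apply: (sP i).2; apply: (lt_le_trans xa); exact: bigmin_le.
Qed.

End combination.

Lemma sum_eE (R : realType) j (a : nat -> R) k :
  (\sum_(i < j.+1) a i *: e_ R i) k = if (k <= j)%N then a k else 0.
Proof.
rewrite fct_sumE (eq_bigr (fun i : 'I_j.+1 => if i == k :> nat then a i else 0)).
  case: ifPn => kj.
    by rewrite -big_mkcond (big_pred1 (Ordinal (kj : (k < j.+1)%N))).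
  rewrite big1// => i _; case: eqP => // ik.
  by move: kj; rewrite -ik -ltnS ltn_ord.
move=> i _; rewrite /e_ /GRing.scale/= eq_sym.
by case: eqP => _; [exact: mulr1|exact: mulr0].
Qed.

(** * Smallness of the functional and of the coordinates *)

Section subadditive_functional.
Variables (R : realType) (F : (nat -> R) -> R).
Hypothesis F_increasing : forall a b, ell_plus a -> ell_plus b ->
  (forall i, a i <= b i) -> F a <= F b.
Hypothesis F_eq0 : forall a, ell_plus a -> (F a = 0 <-> a = 0).

(** Take [r] to be the value of [F] at [e] times the [i]th basis vector, positive as [F] vanishes
    only at 0. If [e <= a i], then [a] dominates this vector and [F a >= r]. *)
Lemma functional_coord_small i (e : R) : 0 < e -> exists2 r, 0 < r &
  forall a, ell_plus a -> F a < r -> a i < e.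
Proof.
move=> e0; pose b : nat -> R := fun k => if k == i then e else 0.
have b0 : ell_plus b by move=> k; rewrite /b; case: ifP => // _; exact: ltW.
have z0 : ell_plus (0 : nat -> R) by move=> k.
exists (F b) => [|a a0 ab].
  rewrite lt_neqAle eq_sym; apply/andP; split.
    apply/eqP => /(F_eq0 b0)/(congr1 (@^~ i)); rewrite /b eqxx => ei0.
    by rewrite ei0 ltxx in e0.
  have F0 : F 0 = 0 by apply/F_eq0.
  by rewrite -F0; apply: F_increasing.
rewrite ltNge; apply/negP => eai; move: ab; rewrite ltNge => /negP; apply.
by apply: F_increasing => // k; rewrite /b; case: eqP => [->|].
Qed.

Hypothesis F_head : forall j : nat,
  (fun v : 'rV[R]_j.+1 => F (\sum_(i < j.+1) v 0 i *: e_ R i))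
    @ within [set v : 'rV[R]_j.+1 | forall i, 0 <= v 0 i]
        (nbhs (0 : 'rV[R]_j.+1)) --> (0 : R).

Lemma functional_head_small j (e : R) : 0 < e -> exists2 r, 0 < r &
  forall a, ell_plus a -> (forall i : 'I_j.+1, a i < r) ->
    F (fun k => if (k <= j)%N then a k else 0) < e.
Proof.
move=> e0.
have : nbhs (0 : 'rV[R]_j.+1) [set v | (forall i, 0 <= v 0 i) ->
    F (\sum_(i < j.+1) v 0 i *: e_ R i) < e].
  exact: (cvgr_lt _ (@F_head j) _ e0).
(* Balls of row vectors are defined entrywise, so membership in the ball of radius [r] around 0 is a
   bound on each coordinate. *)
move=> /nbhs_ballP[r /= r0 rP].
exists r => // a a0 ar.
suff <- : \sum_(i < j.+1) (\row_k a k) 0 i *: e_ R i =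
    (fun k => if (k <= j)%N then a k else 0).
  apply: rP => /= [|i]; last by rewrite mxE.
  by split=> // i k; rewrite !mxE /ball/= sub0r normrN ger0_norm.
apply/funext => k; rewrite -sum_eE; congr (_ k).
by apply: eq_bigr => i _; rewrite mxE.
Qed.

End subadditive_functional.

(** Agreement of consecutive terms propagates: [y m] and [y n] agree on [I_ m] whenever [m <= n].
    Hence the value at [t] is the same for every index whose set contains [t], and any choice [N t]
    defines the glued map. *)
Lemma glue_chain (I E : Type) (I_ : nat -> set I) (S : set (I -> E))
    (I_increasing : forall n, I_ n `<=` I_ n.+1)
    (I_cover : \bigcup_n I_ n = [set: I])
    (S_glue : forall x : I -> E,
      (exists u : nat -> (I -> E),
        (forall n, S (u n)) /\ forall n, {in I_ n, x =1 u n}) -> S x)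
    (y : nat -> S) :
  (forall i, {in I_ i, \val (y i) =1 \val (y i.+1)}) ->
  exists x : S, forall i, {in I_ i, \val x =1 \val (y i)}.
Proof.
move=> yS.
have subI m n : (m <= n)%N -> I_ m `<=` I_ n.
  move=> /subnK <-; elim: (n - m)%N => [//|k IHk] t /IHk.
  exact: I_increasing.
have y_le m n t : (m <= n)%N -> I_ m t -> \val (y m) t = \val (y n) t.
  move=> /subnK <- mt; elim: (n - m)%N => [//|k ->].
  by rewrite addSn; apply: yS; rewrite inE; apply: subI mt; exact: leq_addl.
have /choice[N NP] : forall t, exists n, I_ n t.
  by move=> t; have : [set: I] t by []; rewrite -I_cover => -[n _ nt]; exists n.
pose x t := \val (y (N t)) t.
have xE n : {in I_ n, x =1 \val (y n)}.
  move=> t /set_mem nt; rewrite /x; case: (leqP (N t) n) => [le|/ltnW le].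
    exact: y_le.
  by rewrite -(y_le _ _ _ le).
have Sx : S x.
  by apply: S_glue; exists (fun n => \val (y n)); split => // n; exact: set_valP.
by exists (SigSub (mem_set Sx)).
Qed.

Theorem corollary4p8 (R : realType) (E : topologicalType) (I : Type)
  (I_ : nat -> set I) (S : set (I -> E)) (F : (nat -> R) -> R)
  (d_ : nat -> pseudometric R S)
  (E_metrisable : metrisable R E)
  (I_nonempty : [set: I] !=set0)
  (I_n_nonempty : forall n, I_ n !=set0)
  (I_increasing : forall n, I_ n `<=` I_ n.+1)
  (I_cover : \bigcup_n I_ n = [set: I])
  (S_nonempty : S !=set0)
  (S_glue : forall x : I -> E,
    (exists u : nat -> (I -> E),
      (forall n, S (u n)) /\ forall n, {in I_ n, x =1 u n}) -> S x)
  (F_ge0 : forall a, ell_plus a -> 0 <= F a)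
  (F_increasing : forall a b, ell_plus a -> ell_plus b ->
    (forall i, a i <= b i) -> F a <= F b)
  (F_subadditive : forall a b, ell_plus a -> ell_plus b ->
    F (a + b) <= F a + F b)
  (F_eq0 : forall a, ell_plus a -> (F a = 0 <-> a = 0))
  (F_head : forall j : nat,
    (fun v : 'rV[R]_j.+1 => F (\sum_(i < j.+1) v 0 i *: e_ R i))
      @ within [set v : 'rV[R]_j.+1 | forall i, 0 <= v 0 i]
          (nbhs (0 : 'rV[R]_j.+1)) --> (0 : R))
  (F_tail :
    ereal_sup (range (fun xy : S * S =>
      (F (tail j (fun i => d_ i xy.1 xy.2)))%:E)) @[j --> \oo] --> 0%:E)
  (d_finer : forall i, pm_finer (d_ i.+1) (d_ i))
  (d_eq0 : forall i (x y : S),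
    d_ i x y = 0 <-> {in I_ i, \val x =1 \val y}) :
  exists d : pseudometric R S,
    (forall x y : S, d x y = F (fun i => d_ i x y)) /\
    is_metric d /\
    (forall u : nat -> S,
      (exists x, pm_cvg_to d u x) <->
      (exists x, forall i, pm_cvg_to (d_ i) u x)) /\
    (forall u : nat -> S,
      pm_cauchy d u <-> forall i, pm_cauchy (d_ i) u) /\
    ((forall i, pm_complete (d_ i)) -> pm_complete d) /\
    ((forall i, pm_separable (d_ i)) -> pm_separable d).
Proof.
have dge x y : ell_plus (fun i => d_ i x y) by move=> i; exact: pm_ge0.
have f_xx x : F (fun i => d_ i x x) = 0.
  by apply/F_eq0 => //; apply/funext => i; exact: pm_xx.
have f_sym (x y : S) : F (fun i => d_ i x y) = F (fun i => d_ i y x).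
  by congr F; apply/funext => i; exact: pm_sym.
have ell_plusD (a b : nat -> R) : ell_plus a -> ell_plus b -> ell_plus (a + b).
  by move=> a0 b0 i; exact: addr_ge0.
have f_triangle y x z :
    F (fun i => d_ i x z) <= F (fun i => d_ i x y) + F (fun i => d_ i y z).
  apply: le_trans (F_subadditive _ _ (dge x y) (dge y z)).
  apply: F_increasing => // [|i]; first exact: ell_plusD.
  exact: pm_triangle.
pose d := Pseudometric (fun x y => F_ge0 _ (dge x y)) f_xx f_sym f_triangle.
have d_small (e : R) : 0 < e -> exists j : nat, exists2 r, 0 < r &
    forall x y, (forall i : 'I_j.+1, d_ i x y < r) -> d x y < e.
  move=> e0; have e20 : 0 < e / 2 by rewrite divr_gt0.
  (* The supremum runs over all pairs, so this [j] bounds the tail by [e / 2] for all [x] and [y] at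
     once. *)
  have [j jP] := @filter_ex nat \oo _ _ (F_tail _ (@nbhs_open_ereal_lt R 0 (fun=> e / 2) e20)).
  have [r r0 rP] := functional_head_small F_head j e20.
  exists j, r => // x y xyr.
  have head_ge0 : ell_plus (fun k => if (k <= j)%N then d_ k x y else 0).
    by move=> k; case: ifP => // _; exact: pm_ge0.
  have tail_ge0 : ell_plus (tail j (fun k => d_ k x y)).
    by move=> k; rewrite /tail; case: ifP => // _; exact: pm_ge0.
  have tail_lt : F (tail j (fun k => d_ k x y)) < e / 2.
    rewrite -lte_fin; apply: le_lt_trans jP.
    by apply: ereal_sup_ubound; exists (x, y).
  apply: (@le_lt_trans _ _ (F (fun k => if (k <= j)%N then d_ k x y else 0) +
      F (tail j (fun k => d_ k x y)))).
    apply: le_trans (F_subadditive _ _ head_ge0 tail_ge0).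
    (* Head and tail both contain the coordinate [j], so their sum only dominates the sequence of
       distances; monotonicity of [F] absorbs this. *)
    apply: F_increasing => // [|k]; first exact: ell_plusD.
    rewrite /tail fctE; case: leqP => [kj|/ltnW ->]; last by rewrite add0r.
    by rewrite lerDl; case: ifP => // _; exact: pm_ge0.
  by rewrite (splitr e) ltrD// rP.
have d_coord_small i (e : R) : 0 < e ->
    exists2 r, 0 < r & forall x y, d x y < r -> d_ i x y < e.
  move=> e0; have [r r0 rP] := functional_coord_small F_increasing F_eq0 i e0.
  by exists r => // x y; exact: (rP (fun i => d_ i x y)).
have cvg_d := combination_cvg_to d_small d_coord_small.
have cauchy_d := combination_cauchy d_small d_coord_small.
exists d; split => //; split.
  (* If [d x y = 0], every [d_ n x y] vanishes, so [x] and [y] agree on each [I_ n], and these cover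
     [I]. *)
  move=> x y /(F_eq0 _ (dge x y)) d0; apply/val_inj/funext => t.
  have : [set: I] t by [].
  rewrite -I_cover => -[n _ nt].
  by apply: ((d_eq0 n x y).1 (congr1 (@^~ n) d0)); rewrite inE.
split.
  by move=> u; split=> -[x] /cvg_d ux; exists x.
split; first exact: cauchy_d.
split; last exact: combination_separable d_small d_finer.
move=> complete_d_ u /cauchy_d uc.
have /choice[y uy] i := complete_d_ i u (uc i).
have [|x xy] := glue_chain I_increasing I_cover S_glue (y := y).
  (* Both [y i] and [y i.+1] are [d_ i]-limits of [u], hence at [d_ i]-distance zero. *)
  move=> i; apply/d_eq0; apply: pm_cvg_to_unique (uy i) _.
  exact: pm_finer_cvg_to (d_finer i) (uy i.+1).
exists x; apply/cvg_d => i; apply: pm_cvg_to_eq0 (uy i).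
by rewrite pm_sym; apply/d_eq0.
Qed.
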